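(* Let $n\ge 2$ and let $i,j,l\in\{1,\dots,n+1\}$ be distinct. Then $w^l_{ij}=w^p_{ij}\circ\psi_l$ is an invariant of elements $\beta\in G_{n+1}^2$ in good condition; that is, if two words in the generators of $G_{n+1}^2$ represent the same element of $G_{n+1}^2$ and this element is in good condition, then the values of $w_{ij}^l$ on the two words are equal in $F_n^2$.
   Context: **The group $G_{n+1}^2$.** It has generators $a_{st}=a_{ts}$ for $2$-element subsets $\{s,t\}\subset\{1,\dots,n+1\}$, with relations $a_{st}^2=1$; $a_{st}a_{uv}=a_{uv}a_{st}$ for distinct $s,t,u,v$; $a_{st}a_{su}a_{tu}=a_{tu}a_{su}a_{st}$ for distinct $s,t,u$. An element is in good condition if each generator $a_{st}$ occurs an even number of times in a word representing it (this does not depend on the word). **The group with parity.** Let $S=\{1,\dots,n+1\}\setminus\{l\}$, a set of $n$ indices (original labels are kept). $G_{n,p}^2$ denotes the group with generators $a_{st}^{\epsilon}=a_{ts}^\epsilon$, $\{s,t\}\subset S$ a $2$-element subset, $\epsilon\in\{0,1\}$ a superscript label (not a power), subject to: (1) $(a_{st}^{\epsilon})^2=1$; (2) $a_{st}^{\epsilon}a_{uv}^{\epsilon'}=a_{uv}^{\epsilon'}a_{st}^{\epsilon}$ for distinct $s,t,u,v$ and all $\epsilon,\epsilon'$; (3) $a_{st}^{\epsilon_{st}}a_{su}^{\epsilon_{su}}a_{tu}^{\epsilon_{tu}}=a_{tu}^{\epsilon_{tu}}a_{su}^{\epsilon_{su}}a_{st}^{\epsilon_{st}}$ for distinct $s,t,u$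 whenever $\epsilon_{st}+\epsilon_{su}+\epsilon_{tu}\equiv0\pmod2$. **The map $\psi_l$.** For a word $\beta=\prod_{r=1}^m a_{i_rj_r}$ in the generators of $G_{n+1}^2$, $\psi_l(\beta)=\prod_{r=1}^m b_r$, where $b_r=1$ if $l\in\{i_r,j_r\}$, and otherwise $b_r=a_{i_rj_r}^{\epsilon_r}$ with $\epsilon_r$ the total number, modulo $2$, of occurrences of $a_{i_rl}$ and $a_{j_rl}$ in $\beta$ before the $r$-th letter. It is known that $\psi_l$ is well defined as a map from elements in good condition of $G_{n+1}^2$ to $G_{n,p}^2$. **The map $w^p_{ij}$.** $F_n^2$ is the group generated by all maps $\sigma:S\setminus\{i,j\}\to\mathbb{Z}_2$ with relations $\sigma^2=1$ for each $\sigma$. Given a word in the generators of $G_{n,p}^2$, let $c_1,\dots,c_m$ be, from left to right, all occurrences of letters $a_{ij}^{\epsilon}$, $\epsilon\in\{0,1\}$. For an occurrence $c$ of $a_{ij}^\epsilon$ and $k\in S\setminus\{i,j\}$ set $i^p_c(k)=N_{ik}^0+N_{jk}^0\bmod 2$ if $\epsilon=0$ and $i^p_c(k)=N_{ik}^0+N_{jk}^1\bmod2$ if $\epsilon=1$, where $N_{st}^\delta$ is the number of occurrences of $a_{st}^\delta$ before $c$. Then $w^p_{ij}$ of the word is $i^p_{c_1}\cdots i^p_{c_m}\in F_n^2$. *)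

(* Defs.v *)
From HB Require Import structures.
From mathcomp Require Import all_boot all_order all_algebra.
From mathcomp Require Import boolp.

Set Implicit Arguments.
Unset Strict Implicit.
Unset Printing Implicit Defensive.

Local Open Scope group_scope.
Local Open Scope quotient_scope.

(* [R u v] is the relation "u = v" between two words in the generators.  In
   the signed words below, [(x, false)] stands for the generator [x] and
   [(x, true)] for its formal inverse. *)
Inductive pres_eq (X : Type) (R : seq X -> seq X -> Prop) :
    seq (X * bool) -> seq (X * bool) -> Prop :=
  | pres_refl u : pres_eq R u u
  | pres_sym u v : pres_eq R u v -> pres_eq R v u
  | pres_trans u v w : pres_eq R u v -> pres_eq R v w -> pres_eq R u w
  | pres_cat u u' v v' :
      pres_eq R u u' -> pres_eq R v v' -> pres_eq R (u ++ v) (u' ++ v')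
  | pres_cancel x b : pres_eq R [:: (x, b); (x, ~~ b)] [::]
  | pres_relator u v :
      R u v -> pres_eq R [seq (x, false) | x <- u] [seq (x, false) | x <- v].

Definition pres_eqb (X : choiceType) (R : seq X -> seq X -> Prop)
  : rel (seq (X * bool)) := fun u v => `[< pres_eq R u v >].

Lemma pres_eqb_refl (X : choiceType) (R : seq X -> seq X -> Prop) :
  reflexive (pres_eqb R).
Proof. by move=> u; apply/asboolP; exact: pres_refl. Qed.

Lemma pres_eqb_sym (X : choiceType) (R : seq X -> seq X -> Prop) :
  symmetric (pres_eqb R).
Proof. by move=> u v; apply: asbool_equiv_eq; split; exact: pres_sym. Qed.

Lemma pres_eqb_trans (X : choiceType) (R : seq X -> seq X -> Prop) :
  transitive (pres_eqb R).
Proof.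
move=> v u w /asboolP uv /asboolP vw; apply/asboolP; exact: pres_trans uv vw.
Qed.

Canonical pres_equiv (X : choiceType) (R : seq X -> seq X -> Prop) :=
  EquivRel (pres_eqb R)
    (@pres_eqb_refl X R) (@pres_eqb_sym X R) (@pres_eqb_trans X R).

Definition presented (X : choiceType) (R : seq X -> seq X -> Prop) : Type :=
  {eq_quot (pres_eqb R)}.

HB.instance Definition _ (X : choiceType) (R : seq X -> seq X -> Prop) :=
  Choice.on (presented R).
HB.instance Definition _ (X : choiceType) (R : seq X -> seq X -> Prop) :=
  EqQuotient.on (presented R).

Definition inv_sword (X : Type) (w : seq (X * bool)) : seq (X * bool) :=
  [seq (p.1, ~~ p.2) | p <- rev w].

Definition pres_one (X : choiceType) (R : seq X -> seq X -> Prop)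
  : presented R := \pi_(presented R) [::].
Definition pres_mul (X : choiceType) (R : seq X -> seq X -> Prop)
  (g h : presented R) : presented R := \pi_(presented R) (repr g ++ repr h).
Definition pres_inv (X : choiceType) (R : seq X -> seq X -> Prop)
  (g : presented R) : presented R := \pi_(presented R) (inv_sword (repr g)).

Lemma pres_eqP (X : choiceType) (R : seq X -> seq X -> Prop) u v :
  \pi_(presented R) u = \pi_(presented R) v <-> pres_eq R u v.
Proof.
split; first by move=> /eqmodP /asboolP.
by move=> uv; apply/eqmodP/asboolP.
Qed.

Lemma pres_mulE (X : choiceType) (R : seq X -> seq X -> Prop) u v :
  pres_mul (\pi_(presented R) u) (\pi_(presented R) v)
  = \pi_(presented R) (u ++ v).
Proof.
rewrite /pres_mul; apply/pres_eqP; apply: pres_cat; apply/pres_eqP.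
  by rewrite reprK.
by rewrite reprK.
Qed.

Lemma pres_mulA (X : choiceType) (R : seq X -> seq X -> Prop) :
  associative (@pres_mul X R).
Proof.
move=> a b c; rewrite -[a]reprK -[b]reprK -[c]reprK.
rewrite (pres_mulE R (repr b) (repr c)) (pres_mulE R (repr a) (repr b)).
by rewrite !pres_mulE catA.
Qed.

Lemma pres_mul1 (X : choiceType) (R : seq X -> seq X -> Prop) :
  left_id (pres_one R) (@pres_mul X R).
Proof. by move=> a; rewrite -[a]reprK pres_mulE. Qed.

Lemma pres_mulr1 (X : choiceType) (R : seq X -> seq X -> Prop) :
  right_id (pres_one R) (@pres_mul X R).
Proof. by move=> a; rewrite -[a]reprK pres_mulE cats0. Qed.

Lemma pres_eq_catV (X : Type) (R : seq X -> seq X -> Prop) u :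
  pres_eq R (u ++ inv_sword u) [::].
Proof.
elim: u => [|[x b] u IH]; first exact: pres_refl.
rewrite /inv_sword rev_cons map_rcons -cats1 cat_cons catA -cat1s.
apply: pres_trans (pres_cancel R x b).
rewrite -[[:: _; _]]cat1s; apply: pres_cat; first exact: pres_refl.
rewrite -[X in pres_eq _ _ X]cat0s.
by apply: pres_cat; [exact: IH | exact: pres_refl].
Qed.

Lemma inv_swordK (X : Type) : involutive (@inv_sword X).
Proof.
move=> w; rewrite /inv_sword -map_rev revK -map_comp.
by rewrite -[RHS]map_id; apply: eq_map => -[x b] /=; rewrite negbK.
Qed.

Lemma pres_mulrV (X : choiceType) (R : seq X -> seq X -> Prop) :
  right_inverse (pres_one R) (@pres_inv X R) (@pres_mul X R).
Proof.
move=> a; rewrite -{1}[a]reprK pres_mulE.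
exact/pres_eqP/pres_eq_catV.
Qed.

Lemma pres_mulVr (X : choiceType) (R : seq X -> seq X -> Prop) :
  left_inverse (pres_one R) (@pres_inv X R) (@pres_mul X R).
Proof.
move=> a; rewrite -{2}[a]reprK pres_mulE -{2}[repr a]inv_swordK.
exact/pres_eqP/pres_eq_catV.
Qed.

HB.instance Definition _ (X : choiceType) (R : seq X -> seq X -> Prop) :=
  isGroup.Build (presented R) (@pres_mulA X R) (@pres_mul1 X R)
    (@pres_mulr1 X R) (@pres_mulVr X R) (@pres_mulrV X R).

Definition pres_gen (X : choiceType) (R : seq X -> seq X -> Prop) (x : X)
  : presented R := \pi_(presented R) [:: (x, false)].

Definition pres_word (X : choiceType) (R : seq X -> seq X -> Prop) (w : seq X)
  : presented R := \big[*%g/1]_(x <- w) pres_gen R x.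

Definition edge (I : finType) (S : {set I}) : Type :=
  {A : {set I} | (A \subset S) && (#|A| == 2)}.

HB.instance Definition _ (I : finType) (S : {set I}) := SubFinite.on (edge S).

Inductive G2_rel (I : finType) (S : {set I}) :
    seq (edge S) -> seq (edge S) -> Prop :=
  | G2_square a : G2_rel [:: a; a] [::]
  | G2_commute s t u v a b :
      uniq [:: s; t; u; v] -> val a = [set s; t] -> val b = [set u; v] ->
      G2_rel [:: a; b] [:: b; a]
  | G2_triangle s t u a b c :
      uniq [:: s; t; u] ->
      val a = [set s; t] -> val b = [set s; u] -> val c = [set t; u] ->
      G2_rel [:: a; b; c] [:: c; b; a].

Definition G2 (I : finType) (S : {set I}) := presented (@G2_rel I S).

Definition G2_word (I : finType) (S : {set I}) (w : seq (edge S)) : G2 S :=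
  pres_word (@G2_rel I S) w.

Definition good_condition (I : finType) (S : {set I}) (g : G2 S) : Prop :=
  exists2 w : seq (edge S),
    G2_word w = g & forall a, ~~ odd (count_mem a w).

(* The letter [(a, e)] is the generator a^e, with the label e in {0,1}
   encoded as [false] or [true]. *)
Inductive G2p_rel (I : finType) (S : {set I}) :
    seq (edge S * bool) -> seq (edge S * bool) -> Prop :=
  | G2p_square a : G2p_rel [:: a; a] [::]
  | G2p_commute s t u v a b (e f : bool) :
      uniq [:: s; t; u; v] -> val a = [set s; t] -> val b = [set u; v] ->
      G2p_rel [:: (a, e); (b, f)] [:: (b, f); (a, e)]
  | G2p_triangle s t u a b c (e f h : bool) :
      uniq [:: s; t; u] ->
      val a = [set s; t] -> val b = [set s; u] -> val c = [set t; u] ->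
      ~~ odd (e + f + h) ->
      G2p_rel [:: (a, e); (b, f); (c, h)] [:: (c, h); (b, f); (a, e)].

Definition G2p (I : finType) (S : {set I}) := presented (@G2p_rel I S).

Definition F2_gen (I : finType) (S : {set I}) (i j : I) :=
  {ffun {k : I | k \in S :\: [set i; j]} -> 'Z_2}.

Inductive F2_rel (I : finType) (S : {set I}) (i j : I) :
    seq (F2_gen S i j) -> seq (F2_gen S i j) -> Prop :=
  | F2_square sigma : F2_rel [:: sigma; sigma] [::].

Definition F2 (I : finType) (S : {set I}) (i j : I) :=
  presented (@F2_rel I S i j).

(* Replace each letter [x] of a word by [f p x], deleting it when this is
   [None], where [p] is [pre] followed by the letters to the left of [x]. *)
Fixpoint pmap_prefix (A B : Type) (f : seq A -> A -> option B)
    (pre w : seq A) : seq B :=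
  if w is x :: w' then
    let rest := pmap_prefix f (rcons pre x) w' in
    if f pre x is Some y then y :: rest else rest
  else [::].

Definition occ (I : finType) (S : {set I}) (s t : I) (w : seq (edge S)) : nat :=
  count (fun a => val a == [set s; t]) w.

(* [insub (val a)] is [None] exactly when [l] belongs to the pair [a]. *)
Definition psi_letter (I : finType) (l : I) (pre : seq (edge [set: I]))
    (a : edge [set: I]) : option (edge [set~ l] * bool) :=
  omap (fun b : edge [set~ l] => (b, odd (\sum_(s in val a) occ s l pre)))
    (insub (val a)).

Definition psi (I : finType) (l : I) (beta : seq (edge [set: I])) :
    seq (edge [set~ l] * bool) :=
  pmap_prefix (psi_letter l) [::] beta.

Definition occp (I : finType) (S : {set I}) (s t : I) (d : bool)
    (w : seq (edge S * bool)) : nat :=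
  count (fun c => (val c.1 == [set s; t]) && (c.2 == d)) w.

Definition wp_letter (I : finType) (S : {set I}) (i j : I)
    (pre : seq (edge S * bool)) (c : edge S * bool) :
    option (F2_gen S i j) :=
  if val c.1 == [set i; j] then
    Some [ffun k => (if c.2 then occp i (val k) false pre
                                 + occp j (val k) true pre
                     else occp i (val k) false pre
                          + occp j (val k) false pre)%N%:R%R]
  else None.

Definition wp (I : finType) (S : {set I}) (i j : I)
    (w : seq (edge S * bool)) : F2 S i j :=
  pres_word (@F2_rel I S i j) (pmap_prefix (@wp_letter I S i j) [::] w).

Definition wl (I : finType) (i j l : I) (beta : seq (edge [set: I])) :
    F2 [set~ l] i j :=
  wp i j (psi l beta).

(* Main.v *)
Require Import Defs.
From mathcomp Require Import all_boot all_order all_algebra.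

(** Both maps that make up [wl], namely [psi l] and [wp i j], rewrite a word
    letter by letter, and what becomes of a letter depends only on the parities
    of the numbers of letters of each kind to its left.  In the defining
    relations of both source groups the two sides have the same letters up to
    cancelling pairs, so substituting one side for the other inside a word does
    not affect what happens further right.  Invariance of such a map is
    therefore local: it is enough that the two sides of each relation, read
    after an arbitrary prefix, are rewritten to equal elements
    ([pres_word_pmap_prefix]).  Formal inverses cause no trouble, since the
    relations make every generator its own inverse.

    For [psi l] ([psi_relator]) the interesting relation is the triangle
    [a_st a_sx a_tx = a_tx a_sx a_st].  If [l] is not a vertex, the three labels
    are the pairwise sums of the parities that belong to [s], [t] and [x]; their
    total is even, so the image is a triangle relation of the group with parity.
    If [l] is a vertex, only the side opposite to [l] survives, and each of the
    other two sides flips its label.  Either it is the middle letter and flips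
    once in both reading directions, or it is an outer letter and flips twice in
    one direction and never in the other.

    For [wp i j] ([wp_relator]) at most one side of a triangle is [{i, j}].  The
    other two sides, [{i, x}] and [{j, x}], change the value at [x] of the map
    read off at that letter by the same amount, precisely because the sum of the
    three labels is even ([wp_letter_triangle]).  Reversing the triangle thus
    leaves that map the same.  Squares yield [sigma sigma = 1], and commuting
    letters do not see each other. *)

Set Implicit Arguments.
Unset Strict Implicit.
Unset Printing Implicit Defensive.

Local Open Scope group_scope.
Local Open Scope quotient_scope.

Lemma pres_wordE (X : choiceType) (R : seq X -> seq X -> Prop) (w : seq X) :
  pres_word R w = \pi_(presented R) [seq (x, false) | x <- w].
Proof.
elim: w => [|x w IH]; first by rewrite /pres_word big_nil.
by rewrite /pres_word big_cons -/(pres_word R w) IH; exact: pres_mulE.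
Qed.

Lemma pres_word_cat (X : choiceType) (R : seq X -> seq X -> Prop) u v :
  pres_word R (u ++ v) = pres_word R u * pres_word R v.
Proof. exact: big_cat. Qed.

Lemma pres_word_relator (X : choiceType) (R : seq X -> seq X -> Prop) u v :
  R u v -> pres_word R u = pres_word R v.
Proof. by move=> Ruv; rewrite !pres_wordE; exact/pres_eqP/pres_relator. Qed.

Definition same_parity (A : Type) (u v : seq A) : Prop :=
  forall P : pred A, odd (count P u) = odd (count P v).

Lemma same_parity_rev (A : Type) (u : seq A) : same_parity u (rev u).
Proof. by move=> P; rewrite count_rev. Qed.

Lemma same_parity_square (A : Type) (a : A) : same_parity [:: a; a] [::].
Proof. by move=> P /=; rewrite addn0 addnn odd_double. Qed.

Lemma pmap_prefix_cat (A B : Type) (f : seq A -> A -> option B) pre u v :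
  pmap_prefix f pre (u ++ v)
  = pmap_prefix f pre u ++ pmap_prefix f (pre ++ u) v.
Proof.
elim: u pre => [|x u IH] pre /=; first by rewrite cats0.
by rewrite IH cat_rcons; case: (f pre x).
Qed.

(** * Letter-by-letter rewriting governed by parities *)

Section PrefixRewriting.

Variables (A B : choiceType).
Variables (R : seq A -> seq A -> Prop) (Q : seq B -> seq B -> Prop).
Variable f : seq A -> A -> option B.

Hypothesis f_parity : forall pre pre' : seq A,
  same_parity pre pre' -> f pre =1 f pre'.
Hypothesis R_square : forall a, R [:: a; a] [::].
Hypothesis R_parity : forall u v, R u v -> same_parity u v.
Hypothesis R_local : forall pre u v, R u v ->
  pres_word Q (pmap_prefix f pre u) = pres_word Q (pmap_prefix f pre v).

(** If two letters affect [c] in the same way then reading both of them affects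
    [c] as reading one of them twice does, that is, not at all. *)
Lemma letter_pass_twice p q c :
  (forall pre, f (rcons pre p) c = f (rcons pre q) c) ->
  forall pre, f (rcons (rcons pre p) q) c = f pre c.
Proof.
move=> eq_pq pre; rewrite -eq_pq; apply: f_parity => P.
by rewrite -!cats1 -catA count_cat oddD (same_parity_square p P) addbF.
Qed.

Lemma pmap_prefix_parity pre pre' w :
  same_parity pre pre' -> pmap_prefix f pre w = pmap_prefix f pre' w.
Proof.
elim: w pre pre' => [//|x w IH] pre pre' par /=.
rewrite (f_parity par) (IH _ (rcons pre' x)) // => P.
by rewrite -!cats1 !count_cat !oddD par.
Qed.

(** Reading the right factor of a product after either of two equal left factors
    must give the same result, so parities of the unsigned words are carried
    through the induction.  Dropping the signs turns the cancellation of
    [x] against its inverse into the relator [x x = 1]. *)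
Lemma pres_eq_pmap_prefix u v : pres_eq R u v ->
  same_parity (map fst u) (map fst v) /\
  forall pre, pres_word Q (pmap_prefix f pre (map fst u))
            = pres_word Q (pmap_prefix f pre (map fst v)).
Proof.
elim=> {u v} [//|u v _ [par eqw]|u v w _ [par eqw] _ [par' eqw']
  |u u' v v' _ [par eqw] _ [par' eqw']|x b|u v Ruv].
- by split=> [P|pre]; [rewrite par | rewrite eqw].
- by split=> [P|pre]; [rewrite par par' | rewrite eqw eqw'].
- split=> [P|pre]; first by rewrite !map_cat !count_cat !oddD par par'.
  rewrite !map_cat !pmap_prefix_cat !pres_word_cat eqw eqw'.
  congr (_ * pres_word Q _); apply: pmap_prefix_parity => P.
  by rewrite !count_cat !oddD par.
- split=> [|pre]; first exact: same_parity_square.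
  exact: (R_local pre (R_square x)).
- rewrite -!map_comp !map_id.
  by split=> [|pre]; [exact: R_parity | exact: R_local].
Qed.

Lemma pres_word_pmap_prefix u v : pres_word R u = pres_word R v ->
  pres_word Q (pmap_prefix f [::] u) = pres_word Q (pmap_prefix f [::] v).
Proof.
rewrite !pres_wordE => /pres_eqP /pres_eq_pmap_prefix [_ /(_ [::])].
by rewrite -!map_comp !map_id !pres_wordE.
Qed.

End PrefixRewriting.

Lemma eq_set2 (I : finType) (a b c d : I) :
  ([set a; b] == [set c; d]) =
  (a == c) && (b == d) || (a == d) && (b == c).
Proof.
apply/eqP/idP => [E|]; last first.
  by case/orP => /andP [/eqP -> /eqP ->] //; rewrite setUC.
have: a \in [set c; d] by rewrite -E set21.
have: b \in [set c; d] by rewrite -E set22.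
have: c \in [set a; b] by rewrite E set21.
have: d \in [set a; b] by rewrite E set22.
rewrite !inE (eq_sym c a) (eq_sym c b) (eq_sym d a) (eq_sym d b).
by case: (a == c); case: (a == d); case: (b == c); case: (b == d).
Qed.

(** * The defining relations preserve parities *)

Lemma G2_parity (I : finType) (S : {set I}) (u v : seq (edge S)) :
  G2_rel u v -> same_parity u v.
Proof.
case=> [a|s t x y a b *|s t x a b c *]; first exact: same_parity_square.
  exact: (same_parity_rev [:: a; b]).
exact: (same_parity_rev [:: a; b; c]).
Qed.

Lemma G2p_parity (I : finType) (S : {set I}) (u v : seq (edge S * bool)) :
  G2p_rel u v -> same_parity u v.
Proof.
case=> [a|s t x y a b e f *|s t x a b c e f h *].
- exact: same_parity_square.
- exact: (same_parity_rev [:: (a, e); (b, f)]).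
exact: (same_parity_rev [:: (a, e); (b, f); (c, h)]).
Qed.

(** * Invariance of psi *)

Definition psi_label (I : finType) (l s t : I) (w : seq (edge [set: I])) :=
  odd (occ s l w + occ t l w).

Lemma psi_label_rcons (I : finType) (l s t : I) w a :
  psi_label l s t (rcons w a) =
  psi_label l s t w (+) ((val a == [set s; l]) (+) (val a == [set t; l])).
Proof.
rewrite /psi_label /occ -cats1 !count_cat /= !addn0 !oddD !oddb.
by rewrite addbACA.
Qed.

Section Psi.

Variables (I : finType) (l : I).

Lemma psi_letter_parity pre pre' :
  same_parity pre pre' -> psi_letter l pre =1 psi_letter l pre'.
Proof.
move=> par a; rewrite /psi_letter; congr omap.
apply: boolp.funext => b; congr (_, _).
rewrite !(big_morph odd oddD (erefl (odd 0))).
by apply: eq_bigr => s _; exact: par.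
Qed.

Lemma psi_letterE a s t : s != t -> val a = [set s; t] ->
  if (l == s) || (l == t) then forall pre, psi_letter l pre a = None
  else exists2 b : edge [set~ l], val b = [set s; t] &
    forall pre, psi_letter l pre a = Some (b, psi_label l s t pre).
Proof.
move=> st Ea; rewrite -in_set2 -Ea; case: ifPn => la.
  by move=> pre; rewrite /psi_letter insubN // subsetC sub1set inE la.
have Sa : (val a \subset [set~ l]) && (#|val a| == 2).
  by rewrite subsetC sub1set inE la Ea cards2 st.
exists (Sub (val a) Sa) => [|w]; first by rewrite SubK.
rewrite /psi_letter insubT /=; congr (Some (_, odd _)).
by rewrite Ea big_setU1 ?inE //= big_set1.
Qed.

Lemma psi_relator pre u v : G2_rel u v ->
  pres_word (@G2p_rel I [set~ l]) (pmap_prefix (psi_letter l) pre u)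
  = pres_word (@G2p_rel I [set~ l]) (pmap_prefix (psi_letter l) pre v).
Proof.
case=> [a|s t x y a b|s t x a b c].
- have /andP [_ /cards2P [s [t [st Ea]]]] := valP a.
  have := psi_letterE st Ea.
  have [_ /= aE|/norP [ls lt] [a' _ aE]] := ifPn; first by rewrite !aE.
  rewrite /= !aE psi_label_rcons Ea !eq_set2.
  rewrite -!(eq_sym l) (negbTE ls) (negbTE lt) !(andbF, andbT) /= addbF.
  apply: pres_word_relator; exact: G2p_square.
- move=> U Ea Eb; move: (U); rewrite /= !inE !negb_or !andbT.
  move=> /and3P [/and3P [st sx sy] /andP [tx ty] xy].
  have := psi_letterE st Ea; have := psi_letterE xy Eb.
  have ne := (negbTE sx, negbTE sy, negbTE tx, negbTE ty).
  (* Only a letter that shares a vertex with another one can flip its label. *)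
  case: ifPn => [_ bE|lxy [b' Eb' bE]]; case: ifPn => [_ aE|lst [a' Ea' aE]];
    rewrite /= ?aE ?bE // !psi_label_rcons ?Ea ?Eb !eq_set2
    -?(eq_sym s) -?(eq_sym t) !ne !andbF !addbF //.
  exact/pres_word_relator/(G2p_commute _ _ U).
move=> U Ea Eb Ec; move: (U); rewrite /= !inE !negb_or !andbT.
move=> /andP [/andP [st sx] tx].
have := psi_letterE st Ea; have := psi_letterE sx Eb.
have := psi_letterE tx Ec.
have ne' := (negbTE st, negbTE sx, negbTE tx).
have ne := (ne', eq_sym x s, eq_sym x t, eq_sym t s).
have lC := (eq_sym s l, eq_sym t l, eq_sym x l).
(* If [l] is a vertex then one letter survives.  For [l = s] and [l = x] it is
   preceded by both other sides on one side of the relation and by none on the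
   other; for [l = t] it is preceded by exactly one of them in both. *)
have [ls|ls] := boolP (l == s) => /=.
  have [lt lx] : (l == t = false) * (l == x = false) by rewrite (eqP ls) !ne.
  rewrite lt lx => -[c' _ cE] bE aE.
  rewrite /= !(aE, bE, cE) !psi_label_rcons Ea Eb !eq_set2.
  by rewrite !lC ls lt lx !eqxx !ne /= addbT addbT negbK.
have [lt|lt] := boolP (l == t) => /=.
  have lx : l == x = false by rewrite (eqP lt) !ne.
  rewrite lx => cE [b' _ bE] aE.
  rewrite /= !(aE, bE, cE) !psi_label_rcons Ea Ec !eq_set2.
  by rewrite !lC (negbTE ls) lt lx !eqxx !ne.
have [lx cE bE [a' _ aE]|lx] := boolP (l == x).
  rewrite /= !(aE, bE, cE) !psi_label_rcons Eb Ec !eq_set2.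
  by rewrite !lC (negbTE ls) (negbTE lt) lx !eqxx !ne /= addbT addbT negbK.
move=> [c' Ec' cE] [b' Eb' bE] [a' Ea' aE].
rewrite /= !(aE, bE, cE) !psi_label_rcons Ea Eb Ec !eq_set2.
rewrite !lC (negbTE ls) (negbTE lt) (negbTE lx) !ne !andbF !addbF.
apply: pres_word_relator; apply: (G2p_triangle U Ea' Eb' Ec').
(* The labels are [p_s + p_t], [p_s + p_x] and [p_t + p_x]. *)
rewrite /psi_label !oddD !oddb.
by do 3 case: (odd (occ _ l pre)).
Qed.

End Psi.

(** * Invariance of wp *)

(** The label [e] of the letter selects which kind of letters [{j, k}] counts,
    which makes the two cases of the index of an occurrence a single formula. *)
Definition wp_label (I : finType) (S : {set I}) (i j : I) (e : bool) (k : I)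
    (w : seq (edge S * bool)) : bool :=
  odd (occp i k false w + occp j k e w).

Lemma wp_label_rcons (I : finType) (S : {set I}) (i j : I) (e : bool) (k : I)
    (w : seq (edge S * bool)) (a : edge S) (d : bool) :
  wp_label i j e k (rcons w (a, d)) = wp_label i j e k w (+)
    ((val a == [set i; k]) && ~~ d (+) (val a == [set j; k]) && (d == e)).
Proof.
rewrite /wp_label /occp -cats1 !count_cat /= !addn0 !oddD !oddb eqbF_neg.
by rewrite addbACA.
Qed.

Section Wp.

Variables (I : finType) (S : {set I}) (i j : I).
Implicit Types (pre w : seq (edge S * bool)) (a b c : edge S).

Lemma natrZ2_odd n : (n%:R = (odd n)%:R :> 'Z_2)%R.
Proof. by rewrite -modn2 Zp_nat_mod. Qed.

Lemma wp_letter0 pre a e :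
  val a != [set i; j] -> wp_letter i j pre (a, e) = None.
Proof. by rewrite /wp_letter => /negbTE ->. Qed.

Lemma eq_wp_letter pre pre' a e :
  (val a = [set i; j] -> forall k, k != i -> k != j ->
     wp_label i j e k pre = wp_label i j e k pre') ->
  wp_letter i j pre (a, e) = wp_letter i j pre' (a, e).
Proof.
rewrite /wp_letter; case: eqP => // Ea /(_ Ea) eq_label; congr Some.
apply/ffunP => -[k Sk]; rewrite !ffunE /=.
have /norP [ki kj] : ~~ ((k == i) || (k == j)).
  by move: Sk; rewrite !inE => /andP [].
have := eq_label k ki kj; rewrite /wp_label.
by case: (e) => E; rewrite natrZ2_odd E -natrZ2_odd.
Qed.

Lemma wp_letter_parity pre pre' :
  same_parity pre pre' -> wp_letter i j pre =1 wp_letter i j pre'.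
Proof.
move=> par [a e]; apply: eq_wp_letter => _ k _ _.
by rewrite /wp_label /occp !oddD !par.
Qed.

(** Seen from the side [{x, y} = {i, j}], only the value at [k = z] can change.
    There [{x, z}] and [{y, z}] count, in one order or the other, through the
    conditions that the label is 0 and that it equals [e].  As the labels have
    even sum, [e] is the sum of [f] and [h], so [f = 0] exactly when [h = e],
    and [h = 0] exactly when [f = e]. *)
Lemma wp_letter_triangle x y z a b c (e f h : bool) pre :
  x != y -> x != z -> y != z ->
  val a = [set x; y] -> val b = [set x; z] -> val c = [set y; z] ->
  ~~ odd (e + f + h) ->
  wp_letter i j (rcons pre (b, f)) (a, e)
  = wp_letter i j (rcons pre (c, h)) (a, e).
Proof.
move=> xy xz yz Ea Eb Ec par.
have ne' := (negbTE xy, negbTE xz, negbTE yz).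
have ne := (ne', eq_sym z x, eq_sym z y, eq_sym y x).
apply: eq_wp_letter => /eqP; rewrite Ea eq_set2 => Eij k ki kj.
rewrite !wp_label_rcons Eb Ec; congr (_ (+) _).
move: Eij ki kj => /orP [] /andP [/eqP <- /eqP <-] k1 k2;
  rewrite !eq_set2 -!(eq_sym k) (negbTE k1) (negbTE k2) !eqxx !ne;
  move: par; case: (k == z);
  by case: (e); case: (f); case: (h).
Qed.

Lemma wp_relator pre u v : G2p_rel u v ->
  pres_word (@F2_rel I S i j) (pmap_prefix (wp_letter i j) pre u)
  = pres_word (@F2_rel I S i j) (pmap_prefix (wp_letter i j) pre v).
Proof.
case=> [[a e]|s t x y a b e f|s t x a b c e f h].
- have -> : pmap_prefix (wp_letter i j) pre [:: (a, e); (a, e)]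
      = if wp_letter i j pre (a, e) is Some y then [:: y; y] else [::].
    rewrite /= (@eq_wp_letter (rcons pre (a, e)) pre) => [|Ea k ki kj].
      by case: wp_letter.
    rewrite wp_label_rcons Ea !eq_set2 -!(eq_sym k) (negbTE ki) (negbTE kj).
    by rewrite !andbF addbF.
  case: wp_letter => // y.
  apply: pres_word_relator; exact: F2_square.
- move=> U Ea Eb; move: U; rewrite /= !inE !negb_or !andbT.
  move=> /and3P [/and3P [st sx sy] /andP [tx ty] xy].
  have ne := (negbTE sx, negbTE sy, negbTE tx, negbTE ty).
  have bE : wp_letter i j (rcons pre (a, e)) (b, f) = wp_letter i j pre (b, f).
    apply: eq_wp_letter => Eij k _ _; rewrite wp_label_rcons Ea.
    move/eqP: Eij; rewrite Eb eq_set2 => /orP [] /andP [/eqP <- /eqP <-];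
    by rewrite !eq_set2 !ne !andbF addbF.
  have aE : wp_letter i j (rcons pre (b, f)) (a, e) = wp_letter i j pre (a, e).
    apply: eq_wp_letter => Eij k _ _; rewrite wp_label_rcons Eb.
    move/eqP: Eij; rewrite Ea eq_set2 => /orP [] /andP [/eqP <- /eqP <-];
    by rewrite !eq_set2 -!(eq_sym s) -!(eq_sym t) !ne !andbF addbF.
  rewrite /= bE aE; case: (eqVneq (val a) [set i; j]) => [Eij|na].
    rewrite [wp_letter _ _ _ (b, _)]wp_letter0 //.
    by rewrite -Eij Ea Eb eq_set2 -!(eq_sym s) -!(eq_sym t) !ne.
  by rewrite [wp_letter _ _ _ (a, _)]wp_letter0.
move=> U Ea Eb Ec par; move: U; rewrite /= !inE !negb_or !andbT.
move=> /andP [/andP [st sx] tx].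
have ne' := (negbTE st, negbTE sx, negbTE tx).
have ne := (ne', eq_sym x s, eq_sym x t, eq_sym t s).
have [ts xt xs] : [/\ t != s, x != t & x != s] by rewrite !ne.
have [Ea' Eb' Ec'] :
    [/\ val a = [set t; s], val b = [set x; s] & val c = [set x; t]].
  by split; rewrite setUC.
have aP w : wp_letter i j (rcons w (b, f)) (a, e)
            = wp_letter i j (rcons w (c, h)) (a, e).
  exact: (wp_letter_triangle w st sx tx Ea Eb Ec par).
have bP w : wp_letter i j (rcons w (a, e)) (b, f)
            = wp_letter i j (rcons w (c, h)) (b, f).
  apply: (wp_letter_triangle w sx st xt Eb Ea Ec').
  by move: par; case: (e); case: (f); case: (h).
have cP w : wp_letter i j (rcons w (a, e)) (c, h)
            = wp_letter i j (rcons w (b, f)) (c, h).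
  apply: (wp_letter_triangle w tx ts xs Ec Ea' Eb').
  by move: par; case: (e); case: (f); case: (h).
have aE := letter_pass_twice wp_letter_parity (fun w => esym (aP w)).
have cE := letter_pass_twice wp_letter_parity cP.
have ab : val a = [set i; j] -> val b != [set i; j].
  by move=> <-; rewrite Ea Eb eq_set2 !eqxx !ne.
have ac : val a = [set i; j] -> val c != [set i; j].
  by move=> <-; rewrite Ea Ec eq_set2 !eqxx !ne.
have bc : val b = [set i; j] -> val c != [set i; j].
  by move=> <-; rewrite Eb Ec eq_set2 !eqxx !ne.
rewrite /= aE bP cE.
case: (eqVneq (val a) [set i; j]) => [Eij|na].
  by rewrite ![wp_letter _ _ _ (b, f)]wp_letter0 ?ab //
    ![wp_letter _ _ _ (c, h)]wp_letter0 ?ac.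
rewrite ![wp_letter _ _ _ (a, e)]wp_letter0 //.
case: (eqVneq (val b) [set i; j]) => [Eij|nb].
  by rewrite ![wp_letter _ _ _ (c, h)]wp_letter0 ?bc.
by rewrite ![wp_letter _ _ _ (b, f)]wp_letter0.
Qed.

End Wp.

Theorem corollary4p10 (n : nat) (i j l : 'I_n.+1)
    (beta beta' : seq (edge [set: 'I_n.+1])) :
  2 <= n -> uniq [:: i; j; l] ->
  G2_word beta = G2_word beta' ->
  good_condition (G2_word beta) ->
  wl i j l beta = wl i j l beta'.
Proof.
move=> _ _ eq_beta _.
apply: (pres_word_pmap_prefix (@wp_letter_parity _ _ i j) (@G2p_square _ _)
  (@G2p_parity _ _) (@wp_relator _ _ i j)).
exact: (pres_word_pmap_prefix (@psi_letter_parity _ l) (@G2_square _ _)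
  (@G2_parity _ _) (@psi_relator _ l)).
Qed.
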